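(* Let $I$ be a nonzero graded ideal in $A=\mathbb C[z_1,\dots,z_d]$ having a metric basis which is a finite set $\{\phi_1,\dots,\phi_n\}$. Then $I$ is of finite codimension in $\mathbb C[z_1,\dots,z_d]$ and each of the canonical coordinates $z_1,\dots,z_d$ is nilpotent modulo $I$.
   Context: Let $d\ge1$, $A=\mathbb C[z_1,\dots,z_d]$, with the inner product norm $\|\cdot\|$ on $A$ for which monomials are mutually orthogonal and $\|z^\alpha\|^2=\alpha!/|\alpha|!$ (the norm of the symmetric Fock space $H^2(\mathbb C^d)$). An ideal is graded if it is spanned by its homogeneous polynomials. A generator of a graded ideal $I$ is a (finite or infinite) linearly independent set $\Phi$ of homogeneous polynomials in $I$ such that every $g\in I$ is a finite sum $g=f_1\phi_1+\dots+f_r\phi_r$ with $f_k\in A$, $\phi_k\in\Phi$. It is contractive if $\|f_1\phi_1+\dots+f_r\phi_r\|^2\le\|f_1\|^2+\dots+\|f_r\|^2$ for all distinct $\phi_1,\dots,\phi_r\in\Phi$ and all $f_1,\dots,f_r\in A$. A metric basis for a nonzero graded ideal $I$ is a contractive generator $\Phi$ such that every polynomial $g\in I$ of degree $n$ has a representation $g=f_1\phi_1+\dots+f_r\phi_r$ with $\phi_1,\dots,\phi_r$ distinct elements of $\Phi$, $f_k\in A$, satisfying (1) $\deg\phi_k+\deg f_k\le n$ for $k=1,\dots,r$, and (2) $\|g\|^2=\|f_1\|^2+\dots+\|f_r\|^2$. *)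

(* Defs.v *)
From mathcomp Require Export all_boot all_order all_algebra.
From mathcomp Require Export boolp classical_sets functions cardinality reals.
From mathcomp Require Export complex.
From mathcomp Require Export mpoly.

Set Implicit Arguments.
Unset Strict Implicit.
Unset Printing Implicit Defensive.

Import Order.TTheory GRing.Theory Num.Theory.
Local Open Scope classical_set_scope.
Local Open Scope ring_scope.

Section SymmetricFock.
Variables (C : numClosedFieldType) (d : nat).
Implicit Types (p q g : {mpoly C[d]}) (I Phi : set {mpoly C[d]}).

(* alpha! / |alpha|!, the squared norm of z^alpha in H^2(C^d) *)
Definition fock_weight (m : 'X_{1..d}) : C :=
  (\prod_(i < d) (m i)`!)%N%:R / ((mdeg m)`!)%:R.

Definition fock_dot p q : C :=
  \sum_(m <- msupp p) fock_weight m * p@_m * Num.conj q@_m.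

Definition fock_norm p : C := sqrtC (fock_dot p p).

Definition mpoly_ideal I : Prop :=
  [/\ I 0,
      forall p q, I p -> I q -> I (p + q)
    & forall p q, I q -> I (p * q)].

Definition graded_ideal I : Prop :=
  mpoly_ideal I /\
  forall g, I g ->
    exists (r : nat) (c : 'I_r -> C) (h : 'I_r -> {mpoly C[d]}),
      (forall k, I (h k) /\ h k \is homog mdeg) /\
      g = \sum_(k < r) c k *: h k.

Definition lin_indep Phi : Prop :=
  forall (r : nat) (phi : 'I_r -> {mpoly C[d]}) (c : 'I_r -> C),
    injective phi -> (forall k, Phi (phi k)) ->
    \sum_(k < r) c k *: phi k = 0 -> forall k, c k = 0.

Definition generator I Phi : Prop :=
  [/\ lin_indep Phi,
      forall phi, Phi phi -> I phi /\ phi \is homog mdeg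
    & forall g, I g ->
        exists (r : nat) (f phi : 'I_r -> {mpoly C[d]}),
          (forall k, Phi (phi k)) /\ g = \sum_(k < r) f k * phi k].

Definition contractive Phi : Prop :=
  forall (r : nat) (f phi : 'I_r -> {mpoly C[d]}),
    injective phi -> (forall k, Phi (phi k)) ->
    fock_norm (\sum_(k < r) f k * phi k) ^+ 2
      <= \sum_(k < r) fock_norm (f k) ^+ 2.

(* msize is 1 + degree, and 0 at the zero polynomial; mdegree sends the zero
   polynomial to 0, so its uses below treat that case apart. *)
Definition mdegree p : nat := (msize p).-1.

(* The degree bound is void when f k = 0, whose degree is -oo. The
   polynomials phi k are nonzero by linear independence. For g = 0 the empty
   representation qualifies. *)
Definition metric_basis I Phi : Prop :=
  [/\ generator I Phi, contractive Phi
    & forall g, I g ->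
        exists (r : nat) (f phi : 'I_r -> {mpoly C[d]}),
          [/\ injective phi,
              forall k, Phi (phi k),
              g = \sum_(k < r) f k * phi k,
              forall k, f k != 0 ->
                (mdegree (phi k) + mdegree (f k) <= mdegree g)%N
            & fock_norm g ^+ 2 = \sum_(k < r) fock_norm (f k) ^+ 2]].

(* The quotient by I is spanned by finitely many classes. *)
Definition finite_codim I : Prop :=
  exists (r : nat) (b : 'I_r -> {mpoly C[d]}),
    forall p, exists c : 'I_r -> C, I (p - \sum_(k < r) c k *: b k).

Definition nilpotent_mod I p : Prop := exists N : nat, I (p ^+ N).

End SymmetricFock.

(* Main.v *)
From HB Require Import structures.
Require Import Defs.
From mathcomp Require Import zify ring.

(** Write I_n and A_n for the homogeneous polynomials of degree n in I and in A.
    A metric basis (phi_k) says that (f_k) |-> sum_k f_k phi_k is contractive and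
    that every g in I_n attains its norm, which forces sum_k M_k M_k^* to restrict
    on A_n to the orthogonal projection onto I_n, where M_k is multiplication by
    phi_k. Its trace is therefore dim I_n. On the other hand, the trace of
    M_phi M_phi^* on A_n, computed on monomials, satisfies the recurrence
    (n+1) t_{n+1} = (n+d) t_n for n >= deg phi, which is also the recurrence of
    dim A_n. Hence for large n the codimension of I_n in A_n is a constant
    multiple of dim A_n. But I contains some p <> 0, homogeneous of degree m, so
    this codimension is at most dim A_(n+m) - dim A_n in degree n+m, which is
    o(dim A_(n+m)). The constant is therefore 0, i.e. I_n = A_n for large n. *)

Set Implicit Arguments.
Unset Strict Implicit.
Unset Printing Implicit Defensive.

Import Order.TTheory GRing.Theory Num.Theory.
Local Open Scope classical_set_scope.
Local Open Scope ring_scope.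

(** * Linear algebra: idempotents and contractions *)

Lemma mxtrace_idempotent (F : fieldType) n (Q : 'M[F]_n) :
  Q *m Q = Q -> \tr Q = (\rank Q)%:R.
Proof.
move=> QQ.
(* Write [Q] as [col_base Q *m row_base Q] in [Q *m Q = Q] and cancel the outer factors, which have
   full rank. *)
have h : row_base Q *m col_base Q = 1%:M.
  apply: (row_free_inj (row_base_free Q)).
  apply: (can_inj trmxK); apply: (@row_free_inj _ _ _ _ (col_base Q)^T).
    by rewrite /row_free mxrank_tr; exact: col_base_full.
  rewrite -!trmx_mul; congr (_ ^T).
  rewrite mul1mx mulmx_base (mulmxA (col_base Q)) (mulmxA (col_base Q)).
  by rewrite mulmx_base -mulmxA mulmx_base.
transitivity (\tr (col_base Q *m row_base Q)); first by rewrite mulmx_base.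
by rewrite mxtrace_mulC h mxtrace1.
Qed.

Section Hilbert.
Variable C : numClosedFieldType.

Definition adjmx p q (A : 'M[C]_(p, q)) : 'M[C]_(q, p) :=
  (map_mx Num.conj A)^T.

Definition sqnorm q (v : 'rV[C]_q) : C := \sum_j `|v 0 j| ^+ 2.

Lemma sqnormE q (v : 'rV[C]_q) : sqnorm v = \tr (v *m adjmx v).
Proof.
by rewrite trace_mx11 mxE; apply: eq_bigr => j _; rewrite !mxE normCK.
Qed.

Lemma sqnorm_ge0 q (v : 'rV[C]_q) : 0 <= sqnorm v.
Proof. by apply: sumr_ge0 => j _; rewrite exprn_ge0. Qed.

Lemma sqnorm_eq0 q (v : 'rV[C]_q) : sqnorm v = 0 -> v = 0.
Proof.
move=> h; apply/rowP => j; rewrite mxE.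
move/eqP: h; rewrite psumr_eq0 => [/allP/(_ j)|i _]; last exact: exprn_ge0.
by rewrite mem_index_enum => /(_ isT); rewrite expf_eq0 normr_eq0 => /eqP.
Qed.

Lemma adjmxM p q s (A : 'M[C]_(p, q)) (B : 'M[C]_(q, s)) :
  adjmx (A *m B) = adjmx B *m adjmx A.
Proof. by rewrite /adjmx map_mxM trmx_mul. Qed.

Lemma adjmxB p q (A B : 'M[C]_(p, q)) : adjmx (A - B) = adjmx A - adjmx B.
Proof. by rewrite /adjmx map_mxB linearB. Qed.

Lemma adjmxK p q (A : 'M[C]_(p, q)) : adjmx (adjmx A) = A.
Proof. by apply/matrixP => i j; rewrite !mxE conjCK. Qed.

Lemma contraction_isometric_vector p q (T : 'M[C]_(p, q)) (v : 'rV_p) :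
    (forall w : 'rV_p, sqnorm (w *m T) <= sqnorm w) ->
    sqnorm (v *m T) = sqnorm v ->
  v *m T *m adjmx T = v.
Proof.
(* With x = v T T^*: |x - v|^2 = |x|^2 - |v|^2, while contractivity at x gives
   0 <= |v T - x T|^2 <= |v|^2 - |x|^2. *)
move=> contr iso.
set x := v *m T *m adjmx T.
have hb : sqnorm x = \tr (v *m T *m adjmx (x *m T)).
  by rewrite sqnormE {1}/x adjmxM mulmxA.
have hb' : sqnorm x = \tr (x *m T *m adjmx (v *m T)).
  by rewrite sqnormE {2}/x !adjmxM adjmxK !mulmxA.
have ha : \tr (v *m adjmx x) = sqnorm v.
  by rewrite /x !adjmxM adjmxK mulmxA -iso sqnormE !adjmxM !mulmxA.
have ha' : \tr (x *m adjmx v) = sqnorm v.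
  by rewrite /x -iso sqnormE !adjmxM !mulmxA.
have h1 : sqnorm (v *m T - x *m T) <= sqnorm v - sqnorm x.
  rewrite [leLHS]sqnormE adjmxB mulmxBl !mulmxBr !linearB /=.
  rewrite -!sqnormE -hb -hb' iso.
  by rewrite gerDl oppr_le0 subr_ge0; exact: contr.
have h2 : sqnorm (x - v) <= 0.
  rewrite sqnormE adjmxB mulmxBl !mulmxBr !linearB /= ha ha' -!sqnormE.
  by rewrite subrr subr0 -oppr_ge0 opprB; apply: le_trans h1; exact: sqnorm_ge0.
apply/eqP; rewrite -subr_eq0; apply/eqP/sqnorm_eq0/le_anti.
by rewrite h2 sqnorm_ge0.
Qed.

End Hilbert.

(** * Two sequences with the same recurrence *)

(* N n is the dimension in degree n and q n a codimension: q is proportional to N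
   from degree M on, whereas N (n + m) - N n = o(N (n + m)). *)
Lemma codim_eq0_of_rec (d m M : nat) (q N : nat -> nat) :
    (forall n, (0 < N n)%N) ->
    (forall n, n.+1 * N n.+1 = (n + d) * N n)%N ->
    (forall n, M <= n -> n.+1 * q n.+1 = (n + d) * q n)%N ->
    (forall n, q (n + m) + N n <= N (n + m))%N ->
  (0 < d)%N -> q M = 0%N.
Proof.
move=> N0 Nrec qrec qle d0; apply/eqP; rewrite -leqn0 leqNgt; apply/negP => qM.
have prop k : (q (M + k) * N M = q M * N (M + k))%N.
  elim: k => [|k IH]; first by rewrite addn0 mulnC.
  apply/eqP; rewrite -(eqn_pmul2l (ltn0Sn (M + k))) addnS mulnA.
  rewrite qrec ?leq_addr // mulnCA Nrec -mulnA IH; apply/eqP; lia.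
have Nmono : {homo N : i j / (i <= j)%N}.
  apply: homo_leq => // [y x z|n]; first exact: leq_trans.
  rewrite -(leq_pmul2l (ltn0Sn n)) Nrec leq_mul2r; apply/orP; right; lia.
(* As [(k+1)(N (k+1) - N k) = (d-1) N k], each of the [j] increments is at most the fraction
   [(d-1)/(n+1)] of [N (n+j)]. *)
have slow n j : (n.+1 * N (n + j) <= j * d.-1 * N (n + j) + n.+1 * N n)%N.
  elim: j => [|j IH]; first by rewrite addn0 mul0n.
  have := Nrec (n + j)%N; have := Nmono _ _ (leqnSn (n + j)).
  rewrite addnS; set a := N (n + j); set b := N _.+1 => ab rec.
  have h1 : (n.+1 * b <= n.+1 * a + d.-1 * b)%N by nia.
  have h2 : (j * d.-1 * a <= j * d.-1 * b)%N by rewrite leq_mul2l ab orbT.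
  by apply: (leq_trans h1); move: IH h2; rewrite -/a (mulSn j) !mulnDl; lia.
(* The inequalities below force [n+1 <= N M * m * (d-1)], which this [n] violates; the summand [M]
   lets [prop] apply at [n + m]. *)
pose n := (N M * (m * d.-1) + M)%N.
have Mn : (M <= n + m)%N by rewrite /n -addnA -addnCA leq_addr.
have := slow n m; have := qle n; have /(_ (n + m - M)%N) := prop.
rewrite (subnKC Mn).
have := N0 (n + m)%N; have := N0 M.
set a := N (n + m)%N; set b := N n; set c := q _ => NM a0 e1 e2 e3.
have e4 : (a <= N M * c)%N by nia.
have e5 : (N M * c + N M * b <= N M * a)%N by rewrite -mulnDr leq_mul2l e2 orbT.
have e6 : (N M * (n.+1 * a) <= N M * (m * d.-1 * a) + n.+1 * (N M * b))%N.
  have : (N M * (n.+1 * a) <= N M * (m * d.-1 * a + n.+1 * b))%N.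
    by rewrite leq_mul2l e3 orbT.
  lia.
have e7 : (n.+1 * a <= N M * (m * d.-1) * a)%N by nia.
by move: e7; rewrite leq_pmul2r // /n; lia.
Qed.

(** * Sums over the monomials of a given degree *)

(** Both sides sum [F] over the same duplicate-free list up to order, so no bijection between the
    index types has to be built. *)
Lemma big_same_image (T : eqType) (A B : finType) (V : nmodType)
    (P : pred A) (Q : pred B) (f : A -> T) (g : B -> T) (F : T -> V) :
    {in P &, injective f} -> {in Q &, injective g} ->
    (forall a, P a -> exists2 b, Q b & g b = f a) ->
    (forall b, Q b -> exists2 a, P a & f a = g b) ->
  \sum_(a | P a) F (f a) = \sum_(b | Q b) F (g b).
Proof.
move=> fI gI fg gf.
rewrite -big_filter -[RHS]big_filter -(big_map f xpredT F) -(big_map g xpredT F).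
apply: perm_big; apply: uniq_perm.
- rewrite map_inj_in_uniq ?filter_uniq ?index_enum_uniq // => x y.
  by rewrite !mem_filter => /andP[Px _] /andP[Py _]; apply: fI.
- rewrite map_inj_in_uniq ?filter_uniq ?index_enum_uniq // => x y.
  by rewrite !mem_filter => /andP[Px _] /andP[Py _]; apply: gI.
move=> x; apply/mapP/mapP => -[y]; rewrite mem_filter => /andP[Py _] ->.
  by have [b Qb <-] := fg _ Py; exists b; rewrite // mem_filter Qb mem_index_enum.
by have [b Qb <-] := gf _ Py; exists b; rewrite // mem_filter Qb mem_index_enum.
Qed.

Section Monomials.
Variable d : nat.
Implicit Types (n : nat) (m c g : 'X_{1..d}).

(** A subtype of a finite type, hence finite; its cardinal is dim A_n. *)
Definition mono n := {a : 'X_{1..d < n.+1} | mdeg a == n}.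

Definition mn n (a : mono n) : 'X_{1..d} := val (val a).

Lemma mn_deg n (a : mono n) : mdeg (mn a) = n.
Proof. exact/eqP/(valP a). Qed.

Lemma mn_inj n : injective (@mn n).
Proof. by move=> a b /val_inj/val_inj. Qed.

Lemma mn_surj n m : mdeg m = n -> exists a : mono n, mn a = m.
Proof.
move=> e; have h : (mdeg m < n.+1)%N by rewrite e.
have h' : mdeg (BMultinom h) == n by apply/eqP.
by exists (Sub (BMultinom h) h').
Qed.

Section Sums.
Variable V : nmodType.
Implicit Type F : 'X_{1..d} -> V.

Lemma sum_mono_bounded n k F : (n < k)%N ->
  \sum_(a : mono n) F (mn a) = \sum_(m : 'X_{1..d < k} | mdeg m == n) F m.
Proof.
move=> nk; apply: (@big_same_image _ _ _ _ xpredT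
  (fun m : 'X_{1..d < k} => mdeg m == n) _ (@bmnm d k)).
- by move=> a b _ _; apply: mn_inj.
- by move=> a b _ _; apply: val_inj.
- move=> a _; have h : (mdeg (mn a) < k)%N by rewrite mn_deg.
  by exists (BMultinom h); rewrite //= mn_deg.
- by move=> m /eqP/mn_surj[a <-]; exists a.
Qed.

Lemma sum_mono_shift g n k F : k = (n + mdeg g)%N ->
  \sum_(a : mono k | (g <= mn a)%MM) F (mn a) =
  \sum_(b : mono n) F (mn b + g)%MM.
Proof.
move=> ->; apply: (@big_same_image _ _ _ _ _ xpredT _ (fun b => mn b + g)%MM).
- by move=> a b _ _; apply: mn_inj.
- by move=> a b _ _ /addIm; apply: mn_inj.
- move=> a ga; have [|b eb] := @mn_surj n (mn a - g)%MM.
    by apply/(@addIn (mdeg g)); rewrite -mdegD submK // mn_deg.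
  by exists b; rewrite // eb submK.
- move=> b _; have [|a ea] := @mn_surj (n + mdeg g) (mn b + g)%MM.
    by rewrite mdegD mn_deg.
  by exists a; rewrite // ea lem_addl.
Qed.

End Sums.

Lemma mono_card_gt0 n : (0 < d)%N -> (0 < #|{: mono n}|)%N.
Proof.
move=> d0; have [|a _] := @mn_surj n (U_(Ordinal d0) *+ n)%MM.
  by rewrite mdegMn mdeg1 mul1n.
by apply/card_gt0P; exists a.
Qed.

(** * Weights, and traces of multiplication by monomials *)

Section Weights.
Variable C : numClosedFieldType.
Local Notation w := (@fock_weight C d).

Lemma fock_weight_gt0 m : 0 < w m.
Proof.
rewrite /fock_weight divr_gt0 ?ltr0n ?fact_gt0 //.
by rewrite prodn_gt0 // => i; rewrite fact_gt0.
Qed.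

Lemma fock_weight_add1 m i :
  (mdeg m).+1%:R * w (m + U_(i))%MM = (m i).+1%:R * w m.
Proof.
rewrite /fock_weight mdegD mdeg1 addn1 factS natrM.
have -> : (\prod_(j < d) ((m + U_(i))%MM j)`! = (m i).+1 * \prod_(j < d) (m j)`!)%N.
  rewrite (bigD1 i) //= [in RHS](bigD1 i) //= mulnA mnmDE mnm1E eqxx addn1 factS.
  congr (_ * _)%N; apply: eq_bigr => j ji.
  by rewrite mnmDE mnm1E eq_sym (negbTE ji) addn0.
rewrite natrM; field.
by rewrite -(natrD _ 1) !pnatr_eq0 -lt0n fact_gt0.
Qed.

(** The trace of [M^* M] on A_n for M the multiplication by z^g, which sends the unit vector z^b /
    sqrt(w(b)) to a vector of squared norm w(b+g) / w(b). *)
Definition shift_sum g n : C := \sum_(b : mono n) w (mn b + g)%MM / w (mn b).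

(* Evaluate sum_b (sum_i b_i) w(b + g) / w(b) over |b| = n + 1 in two ways, the
   second one by substituting b = b' + e_i in the term indexed by i. *)
Lemma shift_sum_rec g n :
  (n.+1 + mdeg g)%:R * shift_sum g n.+1 = (n + mdeg g + d)%:R * shift_sum g n.
Proof.
pose rho b := w (b + g)%MM / w b.
(* The quotient of [fock_weight_add1] at [b + g] by the same at [b], cleared of denominators. *)
have step b i : mdeg b = n ->
    (n.+1 + mdeg g)%:R * ((b i).+1%:R * rho (b + U_(i))%MM)
      = n.+1%:R * ((b i + g i).+1%:R * rho b).
  move=> bn; have := fock_weight_add1 b i; have := fock_weight_add1 (b + g)%MM i.
  rewrite /rho -[(b + U_(i) + g)%MM]addmA [(U_(i) + g)%MM]addmC addmA.
  rewrite mdegD bn mnmDE addSn.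
  have := fock_weight_gt0 b; have := fock_weight_gt0 (b + U_(i))%MM.
  move: (w (b + U_(i))%MM) (w (b + g)%MM) (w b) => z y x.
  move=> /lt0r_neq0 z0 /lt0r_neq0 x0 h1 h2.
  have e : (b i).+1%:R / z = n.+1%:R / x by apply/eqP; rewrite eqr_div // -h2.
  have aux (a1 a2 a3 a4 t : C) : a1 * t = a3 * y -> a2 / z = a4 / x ->
      a1 * (a2 * (t / z)) = a4 * (a3 * (y / x)).
    move=> e1 e2; transitivity (a1 * t * (a2 / z)); first by ring.
    by rewrite e1 e2; ring.
  exact: aux.
apply: (@mulfI _ n.+1%:R); first by rewrite pnatr_eq0.
rewrite mulrCA.
have -> : n.+1%:R * shift_sum g n.+1
    = \sum_(i < d) \sum_(b : mono n) (mn b i).+1%:R * rho (mn b + U_(i))%MM.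
  transitivity (\sum_(b : mono n.+1) \sum_(i < d) (mn b i)%:R * rho (mn b)).
    rewrite /shift_sum mulr_sumr; apply: eq_bigr => b _.
    by rewrite -mulr_suml -natr_sum -mdegE mn_deg.
  rewrite exchange_big; apply: eq_bigr => i _.
  have e := @sum_mono_shift C U_(i)%MM n n.+1 (fun b => (b i)%:R * rho b).
  rewrite (bigID (fun b : mono n.+1 => (U_(i) <= mn b)%MM)) /= e ?mdeg1 ?addn1 //.
  rewrite [X in _ + X]big1 ?addr0; last first.
    by move=> b; rewrite lep1mP negbK => /eqP ->; rewrite mul0r.
  by apply: eq_bigr => b _; rewrite mnmDE mnm1E eqxx addn1.
(* For fixed [b] the factors [b_i + g_i + 1] add up over [i] to [n + |g| + d]. *)
transitivity (\sum_(b : mono n) \sum_(i < d)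
    n.+1%:R * ((mn b i + g i).+1%:R * rho (mn b))).
  rewrite exchange_big mulr_sumr; apply: eq_bigr => b _; rewrite mulr_sumr.
  by apply: eq_bigr => i _; rewrite step ?mn_deg.
rewrite /shift_sum !mulr_sumr; apply: eq_bigr => b _.
rewrite -mulr_sumr -mulr_suml -natr_sum.
congr (_ * (_%:R * _)); under eq_bigr do rewrite -addn1.
by rewrite !big_split /= -!mdegE mn_deg sum_nat_const card_ord muln1.
Qed.

(** The case [g = 0] of [shift_sum_rec]: all quotients of weights are 1. *)
Lemma card_mono_rec n : (n.+1 * #|{: mono n.+1}| = (n + d) * #|{: mono n}|)%N.
Proof.
have h k : shift_sum 0%MM k = #|{: mono k}|%:R.
  rewrite -sum1_card natr_sum; apply: eq_bigr => b _.
  by rewrite addm0 divff ?lt0r_neq0 ?fock_weight_gt0.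
have := shift_sum_rec 0%MM n; rewrite !h mdeg0 !addn0 -!natrM.
by move/eqP; rewrite eqr_nat => /eqP.
Qed.

End Weights.
End Monomials.

(** * Norms and cofactors in orthonormal coordinates *)

Section Fock.
Variables (C : numClosedFieldType) (d : nat).
Implicit Types (p f g : {mpoly C[d]}) (n k : nat).
Local Notation w := (@fock_weight C d).

Lemma mcoeffMXE p (b a : 'X_{1..d}) :
  (p * 'X_[b])@_a = if (b <= a)%MM then p@_(a - b)%MM else 0.
Proof.
case: ifP => ba; first by rewrite -{1}(submK ba) addmC mcoeffMX.
rewrite [p]mpolyE mulr_suml raddf_sum /= big1 // => c _.
rewrite -scalerAl -mpolyXD mcoeffZ mcoeffX; case: eqP => [e|]; last by rewrite mulr0.
by move: ba; rewrite -e lem_addl.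
Qed.

Lemma dhomog_msize_le n p : p \is n.-homog -> (msize p <= n.+1)%N.
Proof.
move=> /dhomogP h; rewrite msizeE; apply/bigmax_leqP_seq => m mp _.
by rewrite h.
Qed.

Lemma fock_norm_bounded k p : (msize p <= k)%N ->
  fock_norm p ^+ 2 = \sum_(m : 'X_{1..d < k}) w m * `|p@_m| ^+ 2.
Proof.
move=> pk; rewrite /fock_norm sqrtCK /fock_dot.
under eq_bigr do rewrite -mulrA -normCK.
rewrite (ssrcomplements.big_mksub 'X_{1..d < k}) ?msupp_uniq //=; last first.
  by move=> m /msize_mdeg_lt/leq_trans; apply.
rewrite [RHS](bigID (fun m : 'X_{1..d < k} => \val m \in msupp p)) /=.
rewrite [X in _ = _ + X]big1 ?addr0 // => m.
by move/memN_msupp_eq0 ->; rewrite normr0 expr0n mulr0.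
Qed.

(* Coordinates of the degree n part of p in the orthonormal basis of normalized
   monomials. *)
Definition fock_coord n p : 'rV[C]_#|{: mono d n}| :=
  \row_a (sqrtC (w (mn (enum_val a))) * p@_(mn (enum_val a))).

Lemma fock_coord_is_linear n : linear (fock_coord n).
Proof.
by move=> c p q; apply/rowP => a; rewrite !mxE mcoeffD mcoeffZ mulrDr mulrCA.
Qed.
HB.instance Definition _ n :=
  GRing.isLinear.Build C {mpoly C[d]} 'rV[C]_#|{: mono d n}| _ (fock_coord n)
    (@fock_coord_is_linear n).

Lemma sqrtw_neq0 m : sqrtC (w m) != 0.
Proof. by rewrite sqrtC_eq0 lt0r_neq0 // fock_weight_gt0. Qed.

Lemma sqrtw_sqr m : `|sqrtC (w m)| ^+ 2 = w m.
Proof. by rewrite -normrX sqrtCK ger0_norm // ltW // fock_weight_gt0. Qed.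

Lemma fock_coord_inj n p q a :
  fock_coord n p = fock_coord n q -> mdeg a = n -> p@_a = q@_a.
Proof.
move=> /rowP e /mn_surj[b <-]; have := e (enum_rank b).
by rewrite !mxE enum_rankK => /mulfI; apply; exact: sqrtw_neq0.
Qed.

Lemma sqnorm_fock_coordE n p :
  sqnorm (fock_coord n p) = \sum_(a : mono d n) w (mn a) * `|p@_(mn a)| ^+ 2.
Proof.
rewrite (reindex _ (onW_bij _ (@enum_val_bij _))) /=.
by apply: eq_bigr => a _; rewrite !mxE normrM exprMn sqrtw_sqr.
Qed.

Lemma sqnorm_fock_coord_le n p : sqnorm (fock_coord n p) <= fock_norm p ^+ 2.
Proof.
rewrite sqnorm_fock_coordE.
have h : (msize p <= maxn (msize p) n.+1)%N by rewrite leq_maxl.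
rewrite (fock_norm_bounded h).
rewrite (@sum_mono_bounded d C n _ (fun a => w a * `|p@_a| ^+ 2)
  (leq_maxr (msize p) n.+1)).
rewrite [leRHS](bigID (fun m : 'X_{1..d < _} => mdeg m == n)) /= lerDl.
by apply: sumr_ge0 => m _; rewrite mulr_ge0 ?exprn_ge0 // ltW ?fock_weight_gt0.
Qed.

Lemma sqnorm_fock_coord n p :
  p \is n.-homog -> sqnorm (fock_coord n p) = fock_norm p ^+ 2.
Proof.
move=> hp; rewrite sqnorm_fock_coordE (fock_norm_bounded (dhomog_msize_le hp)).
rewrite (@sum_mono_bounded d C n _ (fun a => w a * `|p@_a| ^+ 2) (ltnSn n)).
rewrite [RHS](bigID (fun m : 'X_{1..d < _} => mdeg m == n)) /=.
rewrite [X in _ = _ + X]big1 ?addr0 // => m mn0.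
by rewrite (dhomog_nemf_coeff hp mn0) normr0 expr0n mulr0.
Qed.

Section Divide.
Variables (r : nat) (phi : 'I_r -> {mpoly C[d]}) (n : nat).
Local Notation E := ('I_r * 'X_{1..d < n.+1})%type.
Implicit Type e : 'I_#|{: E}|.

(* The map (f_k) |-> degree n part of sum_k f_k phi_k, on cofactors of degree at
   most n, in the orthonormal bases of normalized monomials. *)
Definition divide_mx : 'M[C]_(#|{: E}|, #|{: mono d n}|) :=
  \matrix_(e < #|{: E}|) ((sqrtC (w (enum_val e).2))^-1 *:
             fock_coord n (phi (enum_val e).1 * 'X_[(enum_val e).2])).

(** Reads a row vector as a tuple (f_k). Dividing by [sqrtC (w b)] undoes the normalization of
    monomials, so that the correspondence is isometric. *)
Definition cofactors (v : 'rV[C]_#|{: E}|) (k : 'I_r) : {mpoly C[d]} :=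
  \sum_(b : 'X_{1..d < n.+1})
    (v 0 (enum_rank (k, b)) / sqrtC (w b)) *: 'X_[b].

Lemma msize_cofactors v (k : 'I_r) : (msize (cofactors v k) <= n.+1)%N.
Proof.
apply: (leq_trans (msize_sum _ _ _)); apply/bigmax_leqP => b _.
by apply: (leq_trans (msizeZ_le _ _)); rewrite msizeX bmdeg.
Qed.

Lemma mcoeff_cofactors v (k : 'I_r) (b : 'X_{1..d < n.+1}) :
  (cofactors v k)@_b = v 0 (enum_rank (k, b)) / sqrtC (w b).
Proof.
rewrite raddf_sum (bigD1 b) //= mcoeffZ mcoeffX eqxx mulr1 big1 ?addr0 //.
move=> c cb; rewrite mcoeffZ mcoeffX; case: eqP => [e|]; last by rewrite mulr0.
by move/eqP: cb; case; apply: val_inj.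
Qed.

Lemma sqnorm_cofactors v :
  sqnorm v = \sum_k fock_norm (cofactors v k) ^+ 2.
Proof.
under [RHS]eq_bigr => k _ do rewrite (fock_norm_bounded (msize_cofactors v k)).
rewrite pair_big /= /sqnorm.
rewrite [RHS](reindex _ (onW_bij _ (@enum_val_bij _))) /=.
apply: eq_bigr => e _; rewrite mcoeff_cofactors -surjective_pairing enum_valK.
rewrite normrM exprMn normfV exprVn sqrtw_sqr mulrCA divff ?mulr1 //.
by rewrite lt0r_neq0 ?fock_weight_gt0.
Qed.

Lemma mul_divide_mx v :
  v *m divide_mx = fock_coord n (\sum_k cofactors v k * phi k).
Proof.
rewrite mulmx_sum_row linear_sum /=.
under [RHS]eq_bigr => k _ do rewrite mulr_suml linear_sum.
rewrite pair_big /= [RHS](reindex _ (onW_bij _ (@enum_val_bij _))) /=.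
apply: eq_bigr => e _; rewrite rowK scalerA -scalerAl linearZ /=.
by rewrite -surjective_pairing enum_valK [X in fock_coord n X]mulrC.
Qed.

Lemma cofactors_surj (f : 'I_r -> {mpoly C[d]}) :
  (forall k : 'I_r, msize (f k) <= n.+1)%N ->
  exists v, forall k : 'I_r, cofactors v k = f k.
Proof.
move=> hf; exists (\row_(e < #|{: E}|)
  (sqrtC (w (enum_val e).2) * (f (enum_val e).1)@_(enum_val e).2)).
move=> k; rewrite [RHS](mpolywE (hf k)); apply: eq_bigr => b _.
by rewrite mxE enum_rankK /= mulrAC divff ?mul1r ?sqrtw_neq0.
Qed.

End Divide.
End Fock.

(** * The trace of the Gram matrix *)

Lemma mxtrace_gram (C : numClosedFieldType) p q (T : 'M[C]_(p, q)) :
  \tr (adjmx T *m T) = \sum_a \sum_e `|T e a| ^+ 2.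
Proof.
apply: eq_bigr => a _; rewrite mxE; apply: eq_bigr => e _.
by rewrite !mxE normCK mulrC.
Qed.

Lemma mnm_subKm d (a c : 'X_{1..d}) : (c <= a)%MM -> (a - (a - c))%MM = c.
Proof. by move=> ca; apply/mnmP => i; rewrite !mnmBE subKn //; move/mnm_lepP: ca. Qed.

Lemma mcoeff_pihomog d (R : nzRingType) n (p : {mpoly R[d]}) b :
  (pihomog mdeg n p)@_b = if mdeg b == n then p@_b else 0.
Proof.
have [bn|bn] := eqVneq; last by rewrite (dhomog_nemf_coeff (pihomogP _ _ _)).
rewrite pihomogE [in RHS](mpolyE p) !raddf_sum /= big_mkcond.
apply: eq_bigr => c _; case: eqP => // cn; rewrite mcoeffZ mcoeffX.
by case: eqP cn => [->|_ _]; rewrite ?bn ?mulr0.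
Qed.

Section Gram.
Variables (C : numClosedFieldType) (d r : nat).
Variables (phi : 'I_r -> {mpoly C[d]}) (deg : 'I_r -> nat).
Hypothesis phi_homog : forall k, phi k \is (deg k).-homog.
Local Notation w := (@fock_weight C d).

(* For the matrix of a coisometry onto I_n this is the projection onto I_n. *)
Definition gram_mx n := adjmx (divide_mx phi n) *m divide_mx phi n.

(** For given z^b and z^a only the coefficient of z^(a-b) in [phi k] enters. Hence there are no
    cross terms, and the squared Hilbert-Schmidt norm of multiplication by [phi k] is a weighted sum
    of those for single monomials. *)
Lemma sum_shift_mcoeff n k : (deg k <= n)%N ->
  \sum_(a : mono d n) \sum_(b : 'X_{1..d < n.+1})
     w (mn a) / w b * `|(phi k * 'X_[b])@_(mn a)| ^+ 2
  = \sum_(c : mono d (deg k)) `|(phi k)@_(mn c)| ^+ 2 * shift_sum C (mn c) (n - deg k).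
Proof.
move=> kn.
pose F (a x : 'X_{1..d}) := w a / w x * `|(phi k)@_(a - x)%MM| ^+ 2.
(* Homogeneity of [phi k] leaves the divisors [b] of [a] of degree [n - deg k], which are indexed by
   [c = a - b]. *)
transitivity (\sum_(a : mono d n) \sum_(c : mono d (deg k) | (mn c <= mn a)%MM)
                F (mn a) (mn a - mn c)%MM).
  apply: eq_bigr => a _.
  rewrite -(@big_same_image _ _ _ _
    (fun b : 'X_{1..d < n.+1} => (b <= mn a)%MM && (mdeg b == n - deg k)%N)
    _ (@bmnm d n.+1) _ (F (mn a))).
  - rewrite [RHS]big_mkcond; apply: eq_bigr => b _; rewrite mcoeffMXE /F.
    case: ifP => ba; last by rewrite normr0 expr0n mulr0.
    case: ifP => //= bk.
    rewrite (dhomog_nemf_coeff (phi_homog k)) ?normr0 ?expr0n ?mulr0 //.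
    apply: contraFneq bk => <-.
    have e : n = (mdeg (mn a - b) + mdeg b)%N by rewrite -mdegD submK // mn_deg.
    by rewrite [X in (X - _)%N]e addKn.
  - by move=> b b' _ _; apply: val_inj.
  - move=> c c' ca c'a e; apply: mn_inj.
    by rewrite -(mnm_subKm ca) e mnm_subKm.
  - move=> b /andP[ba /eqP bk]; have [|c ec] := @mn_surj d (deg k) (mn a - b)%MM.
      by apply/(@addIn (mdeg b)); rewrite -mdegD submK // mn_deg bk subnKC.
    by exists c; rewrite ?ec ?mnm_subKm // lem_subr.
  - move=> c ca; have h : (mdeg (mn a - mn c) < n.+1)%N.
      by rewrite ltnS -{2}(mn_deg a) -{2}(submK ca) mdegD leq_addr.
    have e : n = (mdeg (mn a - mn c) + deg k)%N.
      by rewrite -{1}(mn_deg a) -{1}(submK ca) mdegD mn_deg.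
    by exists (BMultinom h) => //=; rewrite lem_subr /= [X in (X - _)%N]e addnK.
rewrite (exchange_big_dep xpredT) //=.
apply: eq_bigr => c _.
rewrite (@sum_mono_shift d C (mn c) (n - deg k) n
  (fun a => F a (a - mn c)%MM)); last first.
  by rewrite mn_deg subnK.
rewrite mulr_sumr; apply: eq_bigr => b _.
by rewrite /F addmK -[in X in `|X|](addmC (mn c)) addmK mulrC.
Qed.

Lemma mxtrace_gram_mx n : (forall k, deg k <= n)%N ->
  \tr (gram_mx n) = \sum_k \sum_(c : mono d (deg k))
     `|(phi k)@_(mn c)| ^+ 2 * shift_sum C (mn c) (n - deg k).
Proof.
move=> kn; rewrite mxtrace_gram.
under [RHS]eq_bigr => k _ do rewrite -(sum_shift_mcoeff (kn k)).
rewrite [RHS]exchange_big /= (reindex _ (onW_bij _ (@enum_rank_bij _))) /=.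
apply: eq_bigr => a _; rewrite pair_big /=.
rewrite (reindex _ (onW_bij _ (@enum_rank_bij _))) /=.
apply: eq_bigr => e _; rewrite !mxE !enum_rankK.
rewrite normrM normrM !exprMn normfV exprVn !sqrtw_sqr.
by rewrite mulrA; congr (_ * _); rewrite mulrC.
Qed.

(** For [|c| = deg k], [shift_sum_rec] at [n - deg k] has coefficients [n + 1] and [n + d],
    independent of [k] and [c], so it passes to linear combinations. *)
Lemma mxtrace_gram_mx_rec n : (forall k, deg k <= n)%N ->
  n.+1%:R * \tr (gram_mx n.+1) = (n + d)%:R * \tr (gram_mx n).
Proof.
move=> kn; rewrite !mxtrace_gram_mx //; last by move=> k; rewrite leqW.
rewrite !mulr_sumr; apply: eq_bigr => k _; rewrite !mulr_sumr.
apply: eq_bigr => c _; rewrite mulrCA [RHS]mulrCA; congr (_ * _).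
have := shift_sum_rec C (mn c) (n - deg k).
by rewrite mn_deg addSn subnK // subSn.
Qed.

End Gram.

(** * The codimension of I_n under a finite metric basis *)

Section Metric.
Variables (C : numClosedFieldType) (d r : nat).
Variables (I : set {mpoly C[d]}) (phi : 'I_r -> {mpoly C[d]}) (deg : 'I_r -> nat).
Hypothesis I_ideal : mpoly_ideal I.
Hypothesis I_phi : forall k, I (phi k).
Hypothesis phi_homog : forall k, phi k \is (deg k).-homog.
Hypothesis contr : forall f : 'I_r -> {mpoly C[d]},
  fock_norm (\sum_k f k * phi k) ^+ 2 <= \sum_k fock_norm (f k) ^+ 2.
Hypothesis attain : forall g, I g -> g != 0 ->
  exists f : 'I_r -> {mpoly C[d]},
    [/\ g = \sum_k f k * phi k, forall k, (msize (f k) <= msize g)%N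
      & fock_norm g ^+ 2 = \sum_k fock_norm (f k) ^+ 2].

Let T n := divide_mx phi n.
Let Q n := gram_mx phi n.

Lemma divide_mx_contr n (v : 'rV_#|{: 'I_r * 'X_{1..d < n.+1}}|) :
  sqnorm (v *m T n) <= sqnorm v.
Proof.
rewrite mul_divide_mx sqnorm_cofactors.
by apply: le_trans (contr _); exact: sqnorm_fock_coord_le.
Qed.

(** Norm-attaining cofactors [v] satisfy [v T T^* = v] by [contraction_isometric_vector];
    multiplying by [T] shows that [Q] fixes [v T], the coordinates of [g]. *)
Lemma fock_coord_gram n g :
  I g -> g \is n.-homog -> fock_coord n g *m Q n = fock_coord n g.
Proof.
move=> Ig hg; have [->|g0] := eqVneq g 0; first by rewrite linear0 mul0mx.
have [f [eg sf ng]] := attain Ig g0.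
have [|v ev] := @cofactors_surj C d r n f.
  by move=> k; apply: leq_trans (sf k) (dhomog_msize_le hg).
have eu : v *m T n = fock_coord n g.
  by rewrite mul_divide_mx eg; congr fock_coord; apply: eq_bigr => k _; rewrite ev.
have iso : sqnorm (v *m T n) = sqnorm v.
  rewrite eu sqnorm_fock_coord // ng sqnorm_cofactors.
  by apply: eq_bigr => k _; rewrite ev.
have := contraction_isometric_vector (@divide_mx_contr n) iso.
by rewrite -eu /Q /gram_mx mulmxA => ->.
Qed.

(** Each row comes from some [phi k * 'X_[b]]: either this lies in I_n and is fixed, or its degree
    is not [n] and the row is 0. *)
Lemma divide_mx_gram n : T n *m Q n = T n.
Proof.
apply/row_matrixP => e; rewrite row_mul rowK -scalemxAl; congr (_ *: _).
set b := (enum_val e).2; set k := (enum_val e).1.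
have hom : phi k * 'X_[b] \is (deg k + mdeg b).-homog.
  by rewrite dhomogM // dhomogX.
have [e_n|ne_n] := eqVneq (deg k + mdeg b)%N n.
  apply: fock_coord_gram; last by move: hom; rewrite [X in X.-homog]e_n.
  by case: I_ideal => _ _ IM; rewrite mulrC; apply: IM.
suff -> : fock_coord n (phi k * 'X_[b]) = 0 by rewrite mul0mx.
apply/rowP => a; rewrite !mxE (dhomog_nemf_coeff hom) ?mulr0 //.
by apply: contraNneq ne_n => <-; apply/eqP/mn_deg.
Qed.

Lemma gram_idem n : Q n *m Q n = Q n.
Proof. by rewrite {1}/Q /gram_mx -mulmxA divide_mx_gram. Qed.

(** The row space of the idempotent [Q n] consists of the coordinates of I_n, so this is the
    codimension of I_n in A_n. *)
Let codim n := \rank (1%:M - Q n).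

Lemma codimE n : (codim n)%:R = #|{: mono d n}|%:R - \tr (Q n).
Proof.
rewrite -mxtrace_idempotent; first by rewrite linearB /= mxtrace1.
by rewrite mulmxBl mul1mx mulmxBr mulmx1 gram_idem subrr subr0.
Qed.

Lemma codimD n : (codim n + \rank (Q n) = #|{: mono d n}|)%N.
Proof.
apply/eqP; rewrite -(eqr_nat C) natrD codimE mxtrace_idempotent ?gram_idem //.
by rewrite subrK.
Qed.

Lemma codim_rec n : (forall k, deg k <= n)%N ->
  (n.+1 * codim n.+1 = (n + d) * codim n)%N.
Proof.
move=> kn; apply/eqP; rewrite -(eqr_nat C) !natrM !codimE !mulrBr.
rewrite (mxtrace_gram_mx_rec phi_homog) // -!natrM.
by rewrite (card_mono_rec d C).
Qed.

(** Since A is a domain, multiplication by [p] embeds A_n in I_(n+m), whose coordinates are fixed by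
    [Q (n + m)]. *)
Lemma card_mono_le_rank_gram p m n : I p -> p != 0 -> p \is m.-homog ->
  (#|{: mono d n}| <= \rank (Q (n + m)))%N.
Proof.
move=> Ip p0 hp.
pose U : 'M[C]_(#|{: mono d n}|, #|{: mono d (n + m)}|) :=
  \matrix_(b < #|{: mono d n}|) fock_coord (n + m) (p * 'X_[mn (enum_val b)]).
have hom (b : 'I_#|{: mono d n}|) : p * 'X_[mn (enum_val b)] \is (n + m).-homog.
  by rewrite addnC dhomogM // dhomogX; apply/eqP/mn_deg.
have UQ : U *m Q (n + m) = U.
  apply/row_matrixP => b; rewrite row_mul rowK fock_coord_gram //.
  by case: I_ideal => _ _ IM; rewrite mulrC; apply: IM.
suff Ufree : row_free U.
  by rewrite -(eqP Ufree) -UQ mxrankM_maxr.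
apply: inj_row_free => v; rewrite mulmx_sum_row => vU.
pose s := \sum_(b < #|{: mono d n}|) v 0 b *: 'X_[mn (enum_val b)] : {mpoly C[d]}.
have ps0 : p * s = 0.
  have ps_hom : p * s \is (n + m).-homog.
    rewrite mulr_sumr rpred_sum // => b _; rewrite -scalerAr rpredZ //.
  apply/mpolyP => a; rewrite mcoeff0.
  have [an|an] := eqVneq (mdeg a) (n + m)%N; last first.
    by rewrite (dhomog_nemf_coeff ps_hom).
  rewrite -(mcoeff0 _ a); apply: (@fock_coord_inj _ _ (n + m)) => //.
  rewrite linear0 -vU mulr_sumr linear_sum; apply: eq_bigr => b _.
  by rewrite -scalerAr linearZ rowK.
have s0 : s = 0 by move/eqP: ps0; rewrite mulf_eq0 (negbTE p0) => /eqP.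
apply/rowP => b; rewrite mxE -(mcoeff0 C (mn (enum_val b))) -s0 raddf_sum /=.
rewrite (bigD1 b) //= mcoeffZ mcoeffX eqxx mulr1 big1 ?addr0 // => c cb.
rewrite mcoeffZ mcoeffX; case: eqP => [/mn_inj/enum_val_inj e|]; last by rewrite mulr0.
by rewrite e eqxx in cb.
Qed.

Lemma metric_contains_degree p m : (0 < d)%N ->
    I p -> p != 0 -> p \is m.-homog ->
    (forall f n, I f -> I (pihomog mdeg n f)) ->
  exists n, forall a, mdeg a = n -> I 'X_[a].
Proof.
move=> d0 Ip p0 hp I_graded; pose M := \max_k deg k.
have kM n k : (M <= n)%N -> (deg k <= n)%N.
  by apply: leq_trans; exact: leq_bigmax.
(* From the largest degree [M] of the [phi k] on, [codim_rec] holds, and this forces [codim] to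
   vanish already at [M]. *)
exists M => a aM.
have c0 : codim M = 0%N.
  apply: (@codim_eq0_of_rec d m M codim (fun n => #|{: mono d n}|)) => //.
  - by move=> n; exact: mono_card_gt0.
  - by move=> n; exact: (card_mono_rec d C).
  - by move=> n Mn; apply: codim_rec => k; exact: kM.
  - by move=> n; rewrite -(codimD (n + m)) leq_add2l (card_mono_le_rank_gram _ Ip).
have Q1 : Q M = 1%:M.
  by apply/esym/eqP; rewrite -subr_eq0 -mxrank_eq0 -/(codim M) c0.
(* As [T^* T = 1] in degree [M], this [v] gives an element [g] of I whose degree [M] part is z^a;
   gradedness then extracts it. *)
pose v := fock_coord M 'X_[a] *m adjmx (T M).
pose g := \sum_k cofactors v k * phi k.
have eg : fock_coord M g = fock_coord M 'X_[a].
  by rewrite -mul_divide_mx -mulmxA -[_ *m divide_mx _ _]/(Q M) Q1 mulmx1.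
have Ig : I g.
  case: I_ideal => I0 ID IM; rewrite /g.
  by elim/big_ind: _ => // k _; exact: IM.
suff <- : pihomog mdeg M g = 'X_[a] by exact: I_graded.
apply/mpolyP => b; rewrite mcoeff_pihomog mcoeffX.
have [bM|bM] := eqVneq; first by rewrite (fock_coord_inj eg bM) mcoeffX.
by case: (a =P b) bM => // <-; rewrite aM eqxx.
Qed.

End Metric.

(** * From one degree to the whole ideal *)

Lemma ideal_pihomog (C : numClosedFieldType) d (I : set {mpoly C[d]}) f k :
  graded_ideal I -> I f -> I (pihomog mdeg k f).
Proof.
move=> [[I0 ID IM] Igr] /Igr[r [c [h [hI ->]]]].
rewrite linear_sum; elim/big_ind: _ => // i _; rewrite linearZ /=.
have [Ih /homogP[e he]] := hI i.
have [<-|ek] := eqVneq e k; first by rewrite pihomog_dE // -mul_mpolyC; exact: IM.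
by rewrite (pihomog_ne0 ek he) scaler0.
Qed.

Lemma mnm_sub_degree d n (a : 'X_{1..d}) : (n <= mdeg a)%N ->
  exists2 b : 'X_{1..d}, (b <= a)%MM & mdeg b = n.
Proof.
elim: n => [|n IH] h; first (exists 0%MM; rewrite ?mdeg0 //).
  by apply/mnm_lepP => i; rewrite mnm0E.
have [b ba bn] := IH (ltnW h).
have [i bi] : exists i, (b i < a i)%N.
  apply/existsP; apply: contraLR h; rewrite negb_exists -ltnNge ltnS -bn => /forallP ab.
  by rewrite !mdegE leq_sum // => i _; rewrite leqNgt ab.
exists (b + U_(i))%MM; last by rewrite mdegD mdeg1 bn addn1.
apply/mnm_lepP => j; rewrite mnmDE mnm1E; case: eqP => [<-|_].
  by rewrite addn1.
by rewrite addn0; move/mnm_lepP: ba.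
Qed.

Lemma ideal_contains_degree_ge (C : numClosedFieldType) d (I : set {mpoly C[d]}) n :
    mpoly_ideal I -> (forall a, mdeg a = n -> I 'X_[a]) ->
  forall a, (n <= mdeg a)%N -> I 'X_[a].
Proof.
move=> [_ _ IM] In a /mnm_sub_degree[b ba /In Ib].
by rewrite -(submK ba) mpolyXD; exact: IM.
Qed.

Lemma finite_codim_of_degree (C : numClosedFieldType) d (I : set {mpoly C[d]}) n :
    mpoly_ideal I -> (forall a, mdeg a = n -> I 'X_[a]) -> finite_codim I.
Proof.
move=> I_ideal /(ideal_contains_degree_ge I_ideal) In.
exists #|{: 'X_{1..d < n}}|, (fun k => 'X_[bmnm (enum_val k)]) => p.
exists (fun k => p@_(bmnm (enum_val k))).
have [I0 ID IM] := I_ideal.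
suff -> : \sum_(k < #|{: 'X_{1..d < n}}|) p@_(bmnm (enum_val k)) *: 'X_[bmnm (enum_val k)]
    = \sum_(a <- msupp p | (mdeg a < n)%N) p@_a *: 'X_[a].
  rewrite {1}[p]mpolyE (bigID (fun a => mdeg a < n)%N) /= addrAC subrr add0r.
  elim/big_ind: _ => // a; rewrite -leqNgt -mul_mpolyC => an.
  by apply: IM; exact: In.
rewrite (ssrcomplements.big_mksub_cond 'X_{1..d < n}) ?msupp_uniq //=.
rewrite [RHS]big_mkcond (reindex _ (onW_bij _ (@enum_rank_bij _))) /=.
apply: eq_bigr => b _; rewrite enum_rankK bmdeg /=.
by case: ifPn => // /memN_msupp_eq0 ->; rewrite scale0r.
Qed.

(** A metric basis represents each [g] through its own tuple [t] of distinct elements. This moves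
    the sum to a fixed enumeration [s] of the basis, with cofactor [a0] at elements outside [t]. *)
Lemma sum_enum_injective (V : nmodType) (T : eqType) (A : Type) (r r' : nat)
    (s : 'I_r -> T) (t : 'I_r' -> T) (f : 'I_r' -> A) (a0 : A) (G : A -> T -> V) :
    injective s -> injective t -> (forall k, exists j, s j = t k) ->
    (forall x, G a0 x = 0) ->
  \sum_j G (if [pick k | t k == s j] is Some k then f k else a0) (s j)
    = \sum_k G (f k) (t k).
Proof.
move=> sI tI st G0.
transitivity (\sum_j \sum_(k | t k == s j) G (f k) (t k)).
  apply: eq_bigr => j _; case: pickP => [k /eqP e|h]; last by rewrite big_pred0.
  by rewrite (big_pred1 k) ?e // => k' /=; rewrite -e (inj_eq tI).
rewrite (exchange_big_dep xpredT) //=; apply: eq_bigr => k _.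
have [j e] := st k; rewrite (big_pred1 j) // => j' /=.
by rewrite -e (inj_eq sI) eq_sym.
Qed.

Lemma graded_ideal_homog (C : numClosedFieldType) d (I : set {mpoly C[d]}) :
    graded_ideal I -> (exists2 g, I g & g != 0) ->
  exists p m, [/\ I p, p != 0 & p \is m.-homog].
Proof.
(* The homogeneous component containing the leading monomial of [g] is nonzero. *)
move=> hI [g Ig g0]; exists (pihomog mdeg (mdeg (mlead g)) g), (mdeg (mlead g)).
split; [exact: ideal_pihomog | | exact: pihomogP].
apply: contraNneq g0 => /(congr1 (mcoeff (mlead g))).
by rewrite mcoeff_pihomog eqxx mcoeff0 => /eqP; rewrite mleadc_eq0.
Qed.

Lemma finite_metric_basis_degree (C : numClosedFieldType) d (I Phi : set {mpoly C[d]}) :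
    (0 < d)%N -> graded_ideal I -> (exists2 g, I g & g != 0) ->
    finite_set Phi -> metric_basis I Phi ->
  exists n, forall a, mdeg a = n -> I 'X_[a].
Proof.
move=> d0 hI hI0 /finite_seqP[s0 eS] [[_ PhiI _] contr attain].
have [p [m [Ip p0 hp]]] := graded_ideal_homog hI hI0.
have [I_ideal _] := hI.
(* Contractivity is available only for tuples of distinct elements. *)
pose s := undup s0; pose phi (k : 'I_(size s)) := s`_k.
have phi_in k : Phi (phi k) by rewrite eS /= -mem_undup mem_nth.
have phi_inj : injective phi.
  by move=> i j /eqP; rewrite nth_uniq ?undup_uniq // => /eqP/val_inj.
have phi_surj x : Phi x -> exists k, phi k = x.
  rewrite eS /= -mem_undup -/s => xs.
  by exists (Ordinal (etrans (index_mem x s) xs)); rewrite /phi /= nth_index.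
apply: (@metric_contains_degree C d _ I phi (fun k => (msize (phi k)).-1)
  I_ideal _ _ _ _ p m) => //.
- by move=> k; have [] := PhiI _ (phi_in k).
- by move=> k; have [_] := PhiI _ (phi_in k); rewrite homog_msize.
- by move=> f; exact: contr.
- move=> g Ig g0; have [r [f [psi [psi_inj psi_in eg deg_f norm_g]]]] := attain g Ig.
  have cover k : exists j, phi j = psi k by exact/phi_surj/psi_in.
  exists (fun j => if [pick k | psi k == phi j] is Some k then f k else 0).
  split.
  + rewrite (sum_enum_injective f (G := fun a b => a * b) phi_inj psi_inj cover) //.
    by move=> x; rewrite mul0r.
  + move=> j; case: pickP => [k _|_]; last by rewrite msize0.
    have [->|fk0] := eqVneq (f k) 0; first by rewrite msize0.
    have := deg_f k fk0; rewrite /mdegree.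
    (* Both polynomials are nonzero, so each [msize] is the degree plus one. *)
    have := msize_poly_eq0 (f k); have := msize_poly_eq0 g.
    by rewrite (negbTE fk0) (negbTE g0); lia.
  + rewrite (sum_enum_injective f (G := fun a _ => fock_norm a ^+ 2)
      phi_inj psi_inj cover) //.
    move=> x; rewrite (@fock_norm_bounded _ _ 0) ?msize0 // big1 // => b _.
    by rewrite mcoeff0 normr0 expr0n mulr0.
- by move=> f n; exact: ideal_pihomog.
Qed.

Theorem theoremF (R : realType) (d : nat) (hd : (1 <= d)%N)
    (I : set {mpoly R[i][d]}) (hI : graded_ideal I)
    (hI0 : exists2 g, I g & g != 0)
    (hmb : exists2 Phi : set {mpoly R[i][d]},
             finite_set Phi & metric_basis I Phi) :
  finite_codim I /\ forall i : 'I_d, nilpotent_mod I 'X_i.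
Proof.
have [Phi Phi_fin Phi_mb] := hmb.
have [n In] := finite_metric_basis_degree hd hI hI0 Phi_fin Phi_mb.
have [I_ideal _] := hI; split; first exact: finite_codim_of_degree In.
move=> i; exists n; rewrite mpolyXn; apply: In.
by rewrite mdegMn mdeg1 mul1n.
Qed.
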